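(* Let $\epsilon>0$. Let $G$ be a finite soluble group and let $T=\gamma_\infty(G)$. Suppose that for any prime $p\in\pi(G)$ there is a Sylow $p$-subgroup $P$ of $G$ and a Hall $p'$-subgroup $H$ of $T$ such that $\Pr(H,P)\ge\epsilon$. Then the index $|G:F(G)|$ is $\epsilon$-bounded.
   Context: For subsets $X,Y$ of a finite group, $\Pr(X,Y)=\frac{|\{(x,y)\in X\times Y : xy=yx\}|}{|X||Y|}$. $\pi(G)$ is the set of primes dividing $|G|$. $\gamma_\infty(G)$ is the intersection of all terms of the lower central series of $G$. $F(G)$ is the Fitting subgroup of $G$. A Hall $p'$-subgroup of $T$ is a subgroup of order prime to $p$ whose index in $T$ is a power of $p$. ''$\epsilon$-bounded'' means bounded above by a number depending only on $\epsilon$. *)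

(* Defs.v *)
From HB Require Import structures.
From mathcomp Require Import all_boot all_order all_algebra.
From mathcomp Require Import all_fingroup all_solvable.
From mathcomp Require Import boolp reals.

Set Implicit Arguments.
Unset Strict Implicit.
Unset Printing Implicit Defensive.

Import GroupScope.

Section Definitions.

Variable gT : finGroupType.
Implicit Types (A X Y : {set gT}) (G : {group gT}).

Definition commuting_prob (R : realType) X Y : R :=
  (#|[set u in setX X Y | u.1 * u.2 == u.2 * u.1]%g|%:R
     / (#|X|%:R * #|Y|%:R))%R.

(* The intersection is over all n : nat, hence the classical `[< _ >];
   'L_0(A) and 'L_1(A) are both A by convention. *)
Definition gamma_infty A : {set gT} :=
  [set x | `[< forall n : nat, x \in 'L_n(A) >]].

Lemma gamma_inftyP A x :
  reflect (forall n : nat, x \in 'L_n(A)) (x \in gamma_infty A).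
Proof. by apply: (iffP idP); rewrite inE => /asboolP. Qed.

Fact gamma_infty_group_set G : group_set (gamma_infty G).
Proof.
apply/group_setP; split; first by apply/gamma_inftyP => n; apply: group1.
move=> x y /gamma_inftyP Gx /gamma_inftyP Gy.
by apply/gamma_inftyP => n; rewrite groupM ?Gx ?Gy.
Qed.

Canonical gamma_infty_group G := Group (gamma_infty_group_set G).

End Definitions.

(* Main.v *)
(** Clear denominators: [Pr(H, P) >= 1 / k]. Lower bounds on [Pr] pass to
    subgroups and to quotients.

    Coprime action: if [Q] acts coprimely on an abelian group [A] with
    [Pr(A, Q) >= 1 / k], the elements of [A] with orbits of length at most [m]
    form an increasing family closed under products up to squaring [m], so a
    doubling argument makes one of them a subgroup of bounded index; a subgroup
    all of whose [Q]-orbits are short has a centraliser of bounded index in [Q].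
    For a soluble group [B] with [Pr([B, Q], Q) >= 1 / k] the same conclusion
    follows by passing to [F / F'] with [F = F([B, Q])].

    For a Sylow subgroup [P] of [G], [[O_p'(G), P] = [O_p'(G), P, P]] lies in
    [gamma_infty(G)], hence in every Hall [p']-subgroup of it, so
    [|P : C_P(O_p'(G))|] is bounded. Applied to [G / O_p'(G)] and the primes
    [q != p] this bounds the [p']-part of its order, and then
    [|G : O_{p',p}(G)|]. Since [O_{p',p}(G)] meets the centraliser of [O_p'(G)]
    in a nilpotent normal subgroup, [|P : P :&: F(G)|] is bounded for every [p];
    hence so are the primes dividing [|G : F(G)|] and [|G : F(G)|] itself. *)

Require Import Defs.
From mathcomp Require Import all_boot all_order all_algebra.
From mathcomp Require Import all_fingroup all_solvable.
From mathcomp Require Import boolp reals.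

Set Implicit Arguments.
Unset Strict Implicit.
Unset Printing Implicit Defensive.

Import GroupScope.

(** * Coprime action and the Fitting subgroup *)

(** Since [y] commutes with [[~ x, y]], the power [[~ x, y] ^+ #[y]] is [[~ x, y ^+ #[y]] = 1],
    while [[~ x, y]] has order coprime to that of [y]. *)
Lemma coprime_comm2_cent gT (A G : {group gT}) :
  A \subset 'N(G) -> coprime #|G| #|A| -> [~: G, A, A] = 1 -> A \subset 'C(G).
Proof.
move=> nGA coGA /eqP/comm3G1P cGAA; rewrite centsC; apply/centsP=> x Gx y Ay.
have Rxy : [~ x, y] \in G.
  by rewrite groupMl ?groupV // memJ_norm // (subsetP nGA).
have cRy : commute y [~ x, y].
  by apply/commute_sym/commgP/eqP; apply: cGAA.
have Ryn : [~ x, y] ^+ #[y] = 1.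
  by rewrite -commgX ?expg_order ?commg1.
apply/commgP/eqP/set1gP; rewrite -(coprime_TIg coGA) inE Rxy.
have coR : coprime #[[~ x, y]] #[y].
  by rewrite (coprime_dvdl (order_dvdG Rxy)) // (coprime_dvdr (order_dvdG Ay)).
suff /eqP : #[[~ x, y]] = 1%N by rewrite order_eq1 => /eqP->; apply: group1.
by apply/eqP; rewrite -dvdn1 -(eqP coR) dvdn_gcd dvdnn order_dvdn Ryn /=.
Qed.

(** [A] acts trivially on [G / [~: G, A]], and coprimality lifts fixed points of this quotient to
    [G]. *)
Lemma coprime_comm_mul_cent gT (A G : {group gT}) :
    A \subset 'N(G) -> coprime #|G| #|A| -> solvable G ->
  [~: G, A] * 'C_G(A) = G.
Proof.
move=> nGA coGA solG; have sRG : [~: G, A] \subset G by rewrite commg_subl.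
have nRG : G \subset 'N([~: G, A]) := commg_norml G A.
have nRA : A \subset 'N([~: G, A]) := commg_normr A G.
have coRA := coprimeSg sRG coGA.
have := coprime_norm_quotient_cent nGA nRA coRA (solvableS sRG solG).
have/setIidPl-> : G / [~: G, A] \subset 'C(A / [~: G, A]).
  by rewrite quotient_cents2r.
move/(congr1 (fun X => coset [~: G, A] @*^-1 X)).
by rewrite (@quotientGK _ _ G) ?/normal ?sRG // quotientK ?subIset ?nRG.
Qed.

Lemma coprime_comm_id gT (A G : {group gT}) :
    A \subset 'N(G) -> coprime #|G| #|A| -> solvable G ->
  [~: G, A, A] = [~: G, A].
Proof.
move=> nGA coGA solG; apply/eqP; rewrite eqEsubset.
rewrite commSg ?commg_subl //=.
rewrite -{1}(coprime_comm_mul_cent nGA coGA solG) commMG.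
  rewrite [[~: 'C_G(A), A]](commG1P _) ?mulg1 ?commSg ?subsetIr //.
apply: normsR; first by rewrite subIset ?commg_norml.
by rewrite cents_norm ?subsetIr.
Qed.

Lemma coprime_cent_comm gT (A G H : {group gT}) :
    A \subset 'N(G) -> coprime #|G| #|A| ->
    [~: G, A] \subset H -> A \subset 'C(H) ->
  A \subset 'C(G).
Proof.
move=> nGA coGA sRH cHA; apply: coprime_comm2_cent => //.
by apply/commG1P; rewrite (subset_trans sRH) // centsC.
Qed.

Lemma central_quotient_nil gT (G L : {group gT}) :
  L \subset 'Z(G) -> nilpotent (G / L) -> nilpotent G.
Proof.
move=> sLZ /lcnP[n Ln1]; apply/lcnP; exists n.+1; rewrite lcnSn; apply/commG1P.
have sLnG := lcn_sub n.+1 G; have nLG : G \subset 'N(L).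
  by rewrite cents_norm // centsC (subset_trans sLZ) ?subsetIr.
have : 'L_n.+1(G) / L \subset [1].
  by rewrite /quotient morphim_lcn // -/(quotient _ _) Ln1.
rewrite quotient_sub1 ?(subset_trans sLnG nLG) // => sLnL.
exact: subset_trans sLnL (subset_trans sLZ (subsetIr _ _)).
Qed.

(** With [C] the centraliser, the preimage [K] of ['F(C / 'Z(C))] is nilpotent and characteristic in
    [G], so it lies in ['F(G)], which [C] centralises. Hence [K] lies in ['Z(C)], which forces
    [C = 'Z(C)]. *)
Lemma cent_sub_Fitting gT (G : {group gT}) :
  solvable G -> 'C_G('F(G)) \subset 'F(G).
Proof.
move=> solG; set C := 'C_G('F(G)).
have charC : C \char G by rewrite subcent_char ?char_refl ?gFchar.
have charZ : 'Z(C) \char G := char_trans (center_char _) charC.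
suff abC : abelian C by rewrite Fitting_max ?char_normal ?abelian_nil.
suff : C / 'Z(C) == 1.
  by rewrite -subG1 quotient_sub1 ?gFnorm // subsetI subxx /=.
have solC : solvable (C / 'Z(C)).
  by rewrite quotient_sol ?(solvableS _ solG) ?subsetIl.
rewrite -trivg_Fitting //= -subG1.
have [K defK sZK nsKC] :=
  inv_quotientN (center_normal _) (Fitting_normal (C / 'Z(C))).
have charK : K \char G.
  apply: char_trans charC; apply: (char_from_quotient _ (center_char _)).
    by rewrite /normal sZK (subset_trans (normal_sub nsKC)) ?gFnorm.
  by rewrite -defK gFchar.
have sKC := normal_sub nsKC.
have nilK : nilpotent K.
  apply: (@central_quotient_nil _ _ 'Z(C)); last by rewrite -defK Fitting_nil.
  by rewrite subsetI sZK (subset_trans (subsetIr _ _)) ?centS.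
have cKC : C \subset 'C(K).
  rewrite centsC (subset_trans (Fitting_max (char_normal charK) nilK)) //.
  by rewrite centsC subsetIr.
have nZK : K \subset 'N('Z(C)) := subset_trans sKC (gFnorm _ _).
by rewrite defK quotient_sub1 // subsetI sKC centsC.
Qed.

(** If [H] were proper, subnormality would make its normal closure [K] proper, and [G / K] would be
    nontrivial, nilpotent and perfect. *)
Lemma nil_mul_der1 gT (G H : {group gT}) :
  nilpotent G -> H * G^`(1) = G -> H :=: G.
Proof.
move=> nilG defG; have sHG : H \subset G by rewrite -defG mulG_subl.
have /subnormalEsupport[// | prK] := nilpotent_subnormal nilG sHG.
set K := <<class_support H G>> in prK; have [sKG not_sGK] := andP prK.
have nKG : G \subset 'N(K) by rewrite norms_gen ?class_support_norm.
have ntGK : (G / K)%G :!=: 1 by rewrite -subG1 quotient_sub1.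
have := sol_der1_proper (quotient_sol K (nilpotent_sol nilG)) (subxx _) ntGK.
have /= <- := quotient_der 1 nKG; rewrite properE => /andP[_ /negP[]].
have sHK : H \subset K by rewrite sub_gen ?sub_class_support.
suff -> : G / K = G^`(1) / K by [].
transitivity ((H * G^`(1)) / K); first by rewrite defG.
rewrite quotientMl ?(subset_trans sHK) ?normG //.
by rewrite (_ : H / K = 1) ?mul1g //; apply: quotientS1.
Qed.

(** Since [A] centralises ['F(G)] and [G] normalises it, [[~: G, A]] centralises it too. So
    [[~: G, A]] lies in ['F(G)], where [A] acts trivially. *)
Lemma coprime_cent_Fitting gT (A G : {group gT}) :
    A \subset 'N(G) -> coprime #|G| #|A| -> solvable G ->
  A \subset 'C('F(G)) -> A \subset 'C(G).
Proof.
move=> nGA coGA solG cFA; apply: (coprime_cent_comm nGA coGA) (cFA).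
apply: subset_trans (cent_sub_Fitting solG); rewrite subsetI commg_subl nGA.
exact: comm_norm_cent_cent cFA (gFnorm _ _).
Qed.

Lemma coprime_nil_cent_der1 gT (A G : {group gT}) :
    A \subset 'N(G) -> coprime #|G| #|A| -> nilpotent G ->
  [~: G, A] \subset G^`(1) -> A \subset 'C(G).
Proof.
move=> nGA coGA nilG sRG'; rewrite centsC; apply/setIidPl.
apply: nil_mul_der1 => //; apply/eqP; rewrite eqEsubset.
rewrite mul_subG ?subsetIl ?der_sub //=.
rewrite normC ?(subset_trans (subsetIl _ _)) ?der_norm //.
rewrite -{1}(coprime_comm_mul_cent nGA coGA (nilpotent_sol nilG)).
exact: mulSg.
Qed.

(** * Indices of centralisers and short orbits *)

Lemma leq_indexSg gT (G H K : {group gT}) : K \subset G -> #|K : H| <= #|G : H|.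
Proof. by move=> sKG; rewrite subset_leq_card ?imsetS. Qed.

Lemma leq_indexI gT (G H K : {group gT}) :
  #|G : H :&: K| <= (#|G : H| * #|G : K|)%N.
Proof.
rewrite -[leqLHS]indexgI /= setIA.
rewrite -(Lagrange_index (subsetIl G H) (subsetIl (G :&: H) K)) /= !indexgI.
by rewrite leq_mul ?leq_indexSg ?subsetIl.
Qed.

Lemma leq_indexgS gT (G H K : {group gT}) : H \subset K -> #|G : K| <= #|G : H|.
Proof. by move=> sHK; rewrite dvdn_leq ?indexg_gt0 ?indexgS. Qed.

Lemma index_cent_leq gT (G : {group gT}) (S : {set gT}) m :
  {in S, forall s, #|G : 'C_G[s]| <= m} -> #|G : 'C_G(S)| <= (m ^ #|S|)%N.
Proof.
elim: {S}_.+1 {-2}S (ltnSn #|S|) => // n IHn S leSn boundS.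
have [-> | [s Ss]] := set_0Vmem S.
  by rewrite cards0 (setIidPl _) ?indexgg // centsC sub0set.
rewrite (cardsD1 s) Ss expnS -{1}(setD1K Ss) centU cent_set1 setIIr.
apply: leq_trans (leq_indexI _ _ _) _; rewrite leq_mul ?boundS ?IHn //.
  by rewrite (cardsD1 s) Ss in leSn.
by move=> x /setD1P[_ /boundS].
Qed.

Lemma index_cent_norm_leq gT (G : {group gT}) (S : {set gT}) m :
  G \subset 'N(S) -> #|S| <= m -> #|G : 'C_G(S)| <= (m ^ m)%N.
Proof.
(* Only for empty [S] can [m] be 0, and then [0 ^ 0 = 1] is the right bound. *)
move=> nSG leSm; have [S0 | [s0 Ss0]] := set_0Vmem S.
  apply: leq_trans (index_cent_leq (m := m) _) _ => [s | ]; rewrite S0 ?inE //.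
  by rewrite cards0 expn0; case: (m) => // k; rewrite expn_gt0.
have m_gt0 : 0 < m by apply: leq_trans leSm; rewrite (cardsD1 s0) Ss0.
apply: leq_trans (index_cent_leq (m := m) _) _; last by rewrite leq_pexp2l.
move=> s Ss; rewrite index_cent1 (leq_trans _ leSm) // subset_leq_card //.
by apply/subsetP=> _ /imsetP[x Gx ->]; rewrite memJ_norm // (subsetP nSG).
Qed.

(* If [a] has an orbit of maximal length and [N] is the kernel of the action on
   that orbit, then [A = 'C_A(N) \x [~: A, N]] is an [H]-invariant
   decomposition with [a] in the first factor; adding to [a] a nontrivial [b]
   from the second one would shrink the stabiliser strictly. *)
Lemma abelian_bounded_orbits gT (A H : {group gT}) m :
    abelian A -> H \subset 'N(A) -> coprime #|A| #|H| ->
    {in A, forall a, #|H : 'C_H[a]| <= m} ->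
  #|H : 'C_H(A)| <= (m ^ m)%N.
Proof.
move=> abA nAH coAH orbA.
have [a Aa maxa] :=
  @arg_maxnP _ 1 (fun a => a \in A) (fun a => #|H : 'C_H[a]|) (group1 A).
pose N := 'C_H(a ^: H).
have nOH : H \subset 'N(a ^: H) by apply: class_norm.
have leHN : #|H : N| <= (m ^ m)%N.
  by apply: index_cent_norm_leq; rewrite // -index_cent1 orbA.
apply: leq_trans leHN; apply: leq_indexgS; rewrite subsetI subsetIl /=.
have sNH : N \subset H := subsetIl _ _.
have nNH : H \subset 'N(N) by rewrite normsI ?normG ?norms_cent.
have nAN := subset_trans sNH nAH; have coAN := coprimegS sNH coAH.
apply/commG1P; rewrite -/N commGC; apply: contraTeq isT => /trivgPn[b Rb ntb].
have Ab : b \in A by apply: subsetP Rb; rewrite commg_subl.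
have tiRC := coprime_abel_cent_TI nAN coAN abA.
have sN_Ca : N \subset 'C_H[a].
  by rewrite setIS // -cent_set1 centS // sub1set class_refl.
have cNa : a \in 'C_A(N).
  rewrite inE Aa -sub1set centsC cent_set1.
  exact: subset_trans sN_Ca (subsetIr _ _).
have stab_ab : 'C_H[a * b] \subset 'C_H[a] :&: 'C_H[b].
  apply/subsetP=> x /setIP[Hx /cent1P cxab].
  have nRx : x \in 'N([~: A, N]) by rewrite (subsetP _ _ Hx) // normsR.
  have nCx : x \in 'N('C_A(N)).
    by rewrite (subsetP _ _ Hx) // normsI ?norms_cent.
  have eq_ab : a ^ x * b ^ x = a * b by rewrite -conjMg conjgE -cxab mulKg.
  have eq_ba : a^-1 * a ^ x = b * (b ^ x)^-1.
    by apply: (mulIg (b ^ x)); rewrite -mulgA eq_ab mulKg mulgKV.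
  (* Both factors are [x]-invariant, so by [eq_ba] this element lies in their trivial
     intersection. *)
  have /set1gP a1 : a^-1 * a ^ x \in [1].
    rewrite -tiRC inE {1}eq_ba groupM ?groupV ?memJ_norm //=.
    have /setIP[_ ->] // : a^-1 * a ^ x \in 'C_A(N).
    by rewrite groupM ?groupV ?memJ_norm.
  have fa : a ^ x = a by apply: (mulgI a^-1); rewrite a1 mulVg.
  have fb : b ^ x = b by apply: (mulgI a); rewrite -{1}fa.
  by rewrite !in_setI Hx; apply/andP; split; apply/cent1P;
    rewrite /commute ?[a * x]conjgC ?[b * x]conjgC ?fa ?fb.
have eqC : 'C_H[a * b] = 'C_H[a].
  apply/eqP; rewrite eqEcard (subset_trans stab_ab) ?subsetIl //=.
  rewrite -(leq_pmul2r (indexg_gt0 H 'C_H[a])) Lagrange ?subsetIl //.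
  rewrite -(Lagrange (subsetIl H 'C[a * b])) leq_mul2l.
  by apply/orP; right; apply: maxa; rewrite groupM.
case/negP: ntb; rewrite -in_set1 -[[set 1]]/[1 gT] -tiRC inE Rb.
rewrite -sub1set centsC cent_set1.
apply: subset_trans (subset_trans sN_Ca _) (subsetIr H _).
by rewrite -eqC (subset_trans stab_ab) ?subsetIr.
Qed.

(** * A doubling argument *)

(** While no [B i] is a group, every three stages add at least [#|B 0|] elements; after [3 * k]
    stages there would be [k.+1 * #|B 0|] of them, too many for [A]. *)
Lemma doubling_group gT (A : {group gT}) (B : nat -> {set gT}) k :
    (forall i, B i \subset A) -> (forall i, 1 \in B i) ->
    (forall i, B i * B i \subset B i.+1) ->
    (forall i x, x \in B i -> x^-1 \in B i) -> #|A| <= (k * #|B 0|)%N ->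
  exists2 i, i <= (3 * k)%N & group_set (B i).
Proof.
move=> sBA B1 BM BV leAB.
have sBS i : B i \subset B i.+1.
  by apply: subset_trans (BM i); rewrite -{1}[B i]mulg1 mulgS ?sub1set.
have [/existsP[i gBi] | /existsPn nogrp] :=
  boolP [exists i : 'I_(3 * k)%N.+1, group_set (B i)].
  by exists i; rewrite // -ltnS ltn_ord.
have B0_gt0 : 0 < #|B 0| by rewrite (cardD1 1) B1.
suff /(_ k (leqnn k)) growth :
  forall j, j <= k -> (j.+1 * #|B 0|)%N <= #|B (3 * j)%N|.
  have := leq_trans growth (leq_trans (subset_leq_card (sBA _)) leAB).
  by rewrite leq_pmul2r // ltnn.
elim=> [|j IHj] ltjk; first by rewrite mul1n muln0.
set i := (3 * j)%N in IHj.
have lti : i.+1 < (3 * k)%N.+1.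
  rewrite ltnS (leq_trans _ (leq_mul (leqnn 3) ltjk)) //.
  by rewrite mulnS (leq_add2r i 1 3).
have /subsetPn[_ /mulsgP[x y Bx By ->] notBxy] :
  ~~ (B i.+1 * B i.+1 \subset B i.+1).
  by have := nogrp (Ordinal lti); rewrite /group_set B1.
(* As [x * y] is not in [B i.+1], the sets [B i] and [(x * y) *: B i] are
   disjoint; both lie in [B i.+3]. *)
have disj : [disjoint B i & (x * y) *: B i].
  apply/pred0Pn => -[z /andP[/= Bz /lcosetP[t Bt def_z]]].
  case/negP: notBxy; rewrite -(mulgK t (x * y)) -def_z.
  by apply: (subsetP (BM i)); rewrite mem_mulg ?BV.
have sU : B i :|: (x * y) *: B i \subset B i.+3.
  rewrite subUset (subset_trans (sBS _) (subset_trans (sBS _) (sBS _))) /=.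
  apply: subset_trans (mulgSS _ (subset_trans (sBS _) (sBS _))) (BM i.+2).
  by rewrite sub1set (subsetP (BM i.+1)) // mem_mulg.
have -> : (3 * j.+1)%N = i.+3 by rewrite mulnS addnC addn3.
apply: leq_trans (subset_leq_card sU).
have /eqP disj0 : B i :&: (x * y) *: B i == set0 by rewrite setI_eq0.
rewrite cardsU disj0 cards0 subn0 card_lcoset.
have IH := IHj (ltnW ltjk); rewrite mulSn addnC leq_add //.
by rewrite (leq_trans _ IH) // leq_pmull.
Qed.

(** * Counting commuting pairs *)

(* [Pr(A, B) >= 1 / k], cleared of denominators. *)
Definition commute_often (gT : finGroupType) (k : nat) (A B : {set gT}) :=
  (#|A| * #|B| <= k * \sum_(b in B) #|'C_A[b]|)%N.

Lemma sum_cent1_sym (gT : finGroupType) (A B : {set gT}) :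
  (\sum_(b in B) #|'C_A[b]| = \sum_(a in A) #|'C_B[a]|)%N.
Proof.
have card_cent (X : {set gT}) x : #|'C_X[x]| = (\sum_(y in X) (y \in 'C[x]))%N.
  rewrite -sum1_card big_mkcond [RHS]big_mkcond; apply: eq_bigr => y _.
  by rewrite inE; case: (y \in X); case: (y \in 'C[x]).
under eq_bigr do rewrite card_cent; under [RHS]eq_bigr do rewrite card_cent.
rewrite exchange_big; apply: eq_bigr => a _.
by apply: eq_bigr => b _; rewrite cent1C.
Qed.

(** Each [b] centralises at least as large a fraction of [H] as of [A]. *)
Lemma commute_oftenS gT k (A B H : {group gT}) :
  H \subset A -> commute_often k A B -> commute_often k H B.
Proof.
move=> sHA oftAB; rewrite /commute_often -(leq_pmul2l (cardG_gt0 A)) mulnCA.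
apply: leq_trans (leq_mul (leqnn #|H|) oftAB) _.
rewrite mulnCA [leqRHS]mulnCA leq_mul2l !big_distrr /=; apply/orP; right.
apply: leq_sum => b _.
rewrite -(Lagrange (subsetIl A 'C[b])) -(Lagrange (subsetIl H 'C[b])).
rewrite mulnAC [leqRHS]mulnAC (mulnC #|'C_A[b]|) leq_mul2l !indexgI.
by rewrite leq_indexSg ?orbT.
Qed.

(** ['C_A[c]] maps into the centraliser of the image of [c], with kernel inside [A :&: N]; at most
    [#|B :&: N|] elements [c] of [B] share an image. *)
Lemma commute_often_quotient gT k (A B N : {group gT}) :
    A \subset 'N(N) -> B \subset 'N(N) ->
  commute_often k A B -> commute_often k (A / N) (B / N).
Proof.
move=> nNA nNB; rewrite /commute_often => oftAB.
have card_quo (X : {group gT}) :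
    X \subset 'N(N) -> #|X| = (#|X / N| * #|X :&: N|)%N.
  by move=> nNX; rewrite card_quotient // mulnC LagrangeI.
have bound : (\sum_(b in B) #|'C_A[b]| <=
    (\sum_(y in B / N) #|'C_(A / N)[y]|) * (#|A :&: N| * #|B :&: N|))%N.
  rewrite (partition_big (coset N) (fun y => y \in B / N)) /=; last first.
    by move=> b Bb; rewrite mem_quotient.
  rewrite big_distrl /=; apply: leq_sum => y By; rewrite mulnA.
  have [b Nb Bb def_y] := morphimP By.
  apply: (@leq_trans
    (\sum_(c in B | coset N c == y) (#|'C_(A / N)[y]| * #|A :&: N|))%N).
    apply: leq_sum => c /andP[Bc /eqP <-].
    rewrite (card_quo 'C_A[c]%G) ?subIset ?nNA // leq_mul //; last first.
      by rewrite subset_leq_card ?setSI ?subsetIl.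
    have Nc := subsetP nNB c Bc; rewrite subset_leq_card // subsetI.
    rewrite quotientS ?subsetIl //=.
    exact: subset_trans (quotientS N (subsetIr A _)) (morphim_cent1 _ Nc).
  rewrite sum_nat_const mulnC leq_mul2l -(card_rcoset (B :&: N) b).
  rewrite subset_leq_card ?orbT //.
  apply/subsetP=> c /andP[Bc /eqP eq_cb].
  have Nc := subsetP nNB c Bc.
  rewrite mem_rcoset inE groupM ?groupV //=.
  apply: coset_idr; rewrite ?groupM ?groupV //.
  by rewrite morphM ?morphV ?groupV //= eq_cb def_y mulgV.
have pos : 0 < (#|A :&: N| * #|B :&: N|)%N by rewrite muln_gt0 !cardG_gt0.
rewrite -(leq_pmul2r pos) mulnACA -!card_quo // (leq_trans oftAB) // -mulnA.
by rewrite leq_mul2l bound orbT.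
Qed.

(** Markov's inequality: elements with orbits longer than [2 * k] contribute at most [#|A| * #|H|]
    to [2 * k] times the number of commuting pairs, which is at least [2 * (#|A| * #|H|)]. *)
Lemma commute_often_many gT k (A H : {group gT}) : commute_often k A H ->
  #|A| <= (2 * k * #|[set a in A | (#|H : 'C_H[a]| <= 2 * k)%N]|)%N.
Proof.
rewrite /commute_often sum_cent1_sym => oftAH.
set Y := [set a in A | _].
rewrite -(leq_pmul2r (cardG_gt0 H)) -(leq_add2l (#|A| * #|H|)%N).
have -> : (#|A| * #|H| + #|A| * #|H| = 2 * (#|A| * #|H|))%N.
  by rewrite mul2n addnn.
apply: leq_trans (leq_mul (leqnn 2) oftAH) _.
rewrite mulnA big_distrr (bigID (mem Y)) /= addnC leq_add //.
  rewrite -sum_nat_const big_mkcond [leqRHS]big_mkcond.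
  apply: leq_sum => a _; rewrite inE; case: (a \in A) => //=.
  rewrite -ltnNge; case: ltnP => // ltk.
  by rewrite -(Lagrange (subsetIl H 'C[a])) mulnC leq_mul2l ltnW ?orbT.
rewrite -mulnA -sum_nat_const big_distrr /=.
rewrite (eq_bigl (fun a => a \in Y)) => [|a].
  by apply: leq_sum => a _; rewrite leq_mul2l subset_leq_card ?subsetIl ?orbT.
by rewrite !inE; case: (a \in A).
Qed.

(** * Coprime actions with many commuting pairs *)

(** The orbit length [2 * k], squared once for each of the at most [3 * (2 * k)] stages of
    [doubling_group]. *)
Definition orbit_bound k := ((2 * k) ^ 2 ^ (3 * (2 * k)))%N.

Definition action_bound k :=
  (orbit_bound k ^ orbit_bound k * (2 * k) ^ (2 * k))%N.

Lemma abelian_commute_often gT k (A H : {group gT}) :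
    abelian A -> H \subset 'N(A) -> coprime #|A| #|H| -> commute_often k A H ->
  #|H : 'C_H(A)| <= action_bound k.
Proof.
move=> abA nAH coAH oftAH.
have k_gt0 : 0 < k.
  by case: (k) oftAH => //;
    rewrite /commute_often mul0n leqn0 muln_eq0 !eqn0Ngt !cardG_gt0.
have k2_gt0 : 0 < (2 * k)%N by rewrite muln_gt0.
pose Y m := [set a in A | #|H : 'C_H[a]| <= m].
(* The orbit of a product is at most as long as the product of the two orbit lengths, so squaring
   the threshold yields [B i * B i \subset B i.+1]. *)
pose B i := Y ((2 * k) ^ 2 ^ i)%N.
have [i lei gB] : exists2 i, i <= (3 * (2 * k))%N & group_set (B i).
  apply: (@doubling_group _ A) => [i|i|i|i x|].
  - by apply/subsetP=> a; rewrite inE => /andP[].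
  - by rewrite inE group1 cent11T setIT indexgg expn_gt0 k2_gt0.
  - apply/subsetP=> _ /mulsgP[x y /setIdP[Ax lex] /setIdP[Ay ley] ->].
    rewrite inE groupM //= expnS (mul2n (2 ^ i)%N) -addnn expnD.
    apply: leq_trans (leq_mul lex ley); apply: leq_trans (leq_indexI _ _ _).
    apply: leq_indexgS; apply/subsetP=> h.
    case/setIP=> /setIP[Hh /cent1P cxh] /setIP[_ /cent1P cyh].
    by rewrite inE Hh; apply/cent1P; apply: commuteM.
  - by rewrite !inE groupV -!cent_cycle cycleV.
  exact: commute_often_many oftAH.
pose A0 := Group gB.
have sA0A : A0 \subset A by apply/subsetP=> a; rewrite inE => /andP[].
have nA0H : H \subset 'N(A0).
  apply/subsetP=> x Hx; rewrite inE.
  apply/subsetP=> _ /imsetP[a /setIdP[Aa lea] ->].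
  rewrite inE memJ_norm ?(subsetP nAH) // Aa.
  by rewrite index_cent1 classGidl // -index_cent1.
pose N := 'C_H(A0).
have leHN : #|H : N| <= (orbit_bound k ^ orbit_bound k)%N.
  apply: abelian_bounded_orbits nA0H (coprimeSg sA0A coAH) _ => [|a].
    exact: abelianS abA.
  rewrite inE => /andP[_ /leq_trans]; apply.
  by rewrite /orbit_bound !leq_pexp2l.
have sNH : N \subset H := subsetIl _ _.
have nNH : H \subset 'N(N) by rewrite normsI ?normG ?norms_cent.
have nAN := subset_trans sNH nAH; have coAN := coprimegS sNH coAH.
pose D := [~: A, N].
(* [A0] lies in ['C_A(N)], which meets [[~: A, N]] trivially; as [A0] has index at most [2 * k] in
   [A], this makes [D] small. *)
have tiD : D :&: A0 = 1.
  apply/trivgP; rewrite -(coprime_abel_cent_TI nAN coAN abA) /D setIS //.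
  by rewrite centsC subsetIr.
have leD : #|D| <= (2 * k)%N.
  have leA : #|A| <= (2 * k * #|A0|)%N.
    apply: leq_trans (commute_often_many oftAH) _.
    rewrite leq_mul2l subset_leq_card ?orbT //.
    apply/subsetP=> a /setIdP[Aa lea]; rewrite inE Aa (leq_trans lea) //.
    by rewrite -{1}[(2 * k)%N]expn1 leq_pexp2l ?expn_gt0.
  rewrite -(leq_pmul2r (cardG_gt0 A0)) (leq_trans _ leA) //.
  by rewrite -TI_cardMg // subset_leq_card // mul_subG // commg_subl.
have nDH : H \subset 'N(D) by rewrite normsR.
have leHD := index_cent_norm_leq nDH leD.
apply: leq_trans (leq_mul leHN leHD); apply: leq_trans (leq_indexI _ _ _).
apply: leq_indexgS; rewrite subsetI subIset ?subsetIl //=.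
have sINH : N :&: 'C_H(D) \subset N := subsetIl _ _.
apply: (@coprime_cent_comm _ _ A D); first exact: subset_trans sINH nAN.
- exact: coprimegS coAN.
- exact: commgS.
exact: subset_trans (subsetIr _ _) (subsetIr _ _).
Qed.

Lemma solvable_commute_often gT k (A H : {group gT}) :
    solvable A -> H \subset 'N(A) -> coprime #|A| #|H| ->
    commute_often k [~: A, H] H ->
  #|H : 'C_H(A)| <= action_bound k.
Proof.
move=> solA nAH coAH oft.
set C := [~: A, H]%G in oft; have sCA : C \subset A by rewrite commg_subl.
have nCH : H \subset 'N(C) by apply: commg_normr.
have solC := solvableS sCA solA; have coCH := coprimeSg sCA coAH.
set F := 'F(C)%G; have sFC : F \subset C := Fitting_sub C.
have nFH : H \subset 'N(F) := gFnorm_trans _ nCH.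
have coFH := coprimeSg sFC coCH.
set F' := F^`(1)%G; have nF'H : H \subset 'N(F') := gFnorm_trans _ nFH.
have nF'F : F \subset 'N(F') := der_norm 1 F.
have oftF := commute_often_quotient nF'F nF'H (commute_oftenS sFC oft).
have leD : #|H / F' : 'C_(H / F')(F / F')| <= action_bound k.
  apply: abelian_commute_often oftF; last by rewrite coprime_morph.
    exact: der_abelian 0 F.
  exact: quotient_norms.
set D := (H :&: coset F' @*^-1 'C_(H / F')(F / F'))%G.
have sDH : D \subset H := subsetIl _ _.
(* [D] is trivial on [F / F'], hence on the nilpotent group [F], hence on [C], hence on [A]. *)
apply: leq_trans leD; apply: (@leq_trans #|H : D|).
  apply: leq_indexgS; rewrite subsetI sDH /=.
  have sRC : [~: A, D] \subset C by apply: commgS.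
  apply: (coprime_cent_comm (subset_trans sDH nAH) (coprimegS sDH coAH) sRC).
  apply: (coprime_cent_Fitting (subset_trans sDH nCH)) solC _.
    exact: coprimegS coCH.
  apply: coprime_nil_cent_der1 (subset_trans sDH nFH) (coprimegS sDH coFH) _ _.
    exact: Fitting_nil.
  rewrite -quotient_cents2 ?(subset_trans sDH) // centsC.
  rewrite sub_quotient_pre ?(subset_trans sDH nF'H) //.
  exact: subset_trans (subsetIr _ _) (morphpreS _ (subsetIr _ _)).
by rewrite /D indexgI -index_cosetpre leq_indexSg // -sub_quotient_pre.
Qed.

(** * Bounding an integer by its prime parts *)

Lemma leq_parts n b : 0 < n ->
  (forall q, q \in \pi(n) -> n`_q <= b) -> (n <= b.+1 ^ b.+1)%N.
Proof.
move=> n_gt0 leb.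
have part_q q : q \in \pi(n) -> q < b.+1.
  move=> pi_q; rewrite ltnS (leq_trans _ (leb q pi_q)) //.
  have q_pr : prime q by move: pi_q; rewrite mem_primes => /andP[].
  rewrite dvdn_leq ?part_gt0 //.
  by rewrite p_part -{1}(expn1 q) dvdn_exp2l // logn_gt0.
(* The exponent stops growing once [m] exceeds [b], because larger primes do not divide [n]. *)
suff /(_ n.+1) prod_leq m :
    (\prod_(0 <= q < m) q ^ logn q n <= b.+1 ^ minn m b.+1)%N.
  rewrite -{1}(partnT n_gt0) /partn (leq_trans prod_leq) //.
  by rewrite leq_pexp2l // geq_minr.
elim: m => [|m IHm]; first by rewrite big_geq.
rewrite big_nat_recr //=.
have [pi_m | not_pi_m] := boolP (m \in \pi(n)); last first.
  have /eqP-> : logn m n == 0 by rewrite -leqn0 leqNgt logn_gt0.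
  rewrite muln1 (leq_trans IHm) // leq_pexp2l // leq_min geq_minr andbT.
  by rewrite (leq_trans (geq_minl _ _)).
have ltmb := part_q m pi_m; rewrite (minn_idPl ltmb) expnSr leq_mul //.
  by rewrite (minn_idPl (ltnW ltmb)) in IHm.
by rewrite -p_part leqW ?leb.
Qed.

(** * From Sylow subgroups to the Fitting subgroup *)

(** ['L_n(G)] stands in for [gamma_infty G]: it maps onto the corresponding term of any quotient, so
    one [n] serves for all quotients of [G]. *)
Definition sylow_hall_commute (gT : finGroupType) k n (G : {group gT}) :=
  forall p, p \in \pi(G) -> exists P H : {group gT},
    [/\ p.-Sylow(G) P, p^'.-Hall('L_n(G)) H & commute_often k H P].

Lemma sylow_hall_commute_quotient gT k n (G N : {group gT}) :
  N <| G -> sylow_hall_commute k n G -> sylow_hall_commute k n (G / N).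
Proof.
case/andP=> sNG nNG oftG p pi_p.
have [|P [H [sylP hallH oftHP]]] := oftG p.
  exact: pi_of_dvd (dvdn_quotient _ _) (cardG_gt0 G) _ pi_p.
have nNP := subset_trans (pHall_sub sylP) nNG.
have nNH := subset_trans (subset_trans (pHall_sub hallH) (lcn_sub n G)) nNG.
exists (P / N)%G, (H / N)%G; split; first exact: quotient_pHall.
  by rewrite /= -[G / N]/(coset N @* G) -morphim_lcn // quotient_pHall.
exact: commute_often_quotient.
Qed.

(** As [[~: A, H] = [~: A, H, H]], containment in one term gives containment in the next. *)
Lemma coprime_comm_sub_lcn gT (G A H : {group gT}) n :
    A \subset G -> H \subset G -> H \subset 'N(A) -> coprime #|A| #|H| ->
    solvable A ->
  [~: A, H] \subset 'L_n(G).
Proof.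
move=> sAG sHG nAH coAH solA.
have sRG : [~: A, H] \subset G by apply: subset_trans sAG; rewrite commg_subl.
case: n => [//|]; elim=> [//|n IHn].
by rewrite lcnSn -(coprime_comm_id nAH coAH solA) commgSS.
Qed.

Lemma sylow_index_cent_pcore gT k n (G : {group gT}) p :
    solvable G -> sylow_hall_commute k n G -> p \in \pi(G) ->
  exists2 P : {group gT},
    p.-Sylow(G) P & #|P : 'C_P('O_p^'(G))| <= action_bound k.
Proof.
move=> solG oftG /oftG[P [H [sylP hallH oftHP]]]; exists P => //.
have [sPG pP _] := and3P sylP.
have nOP : P \subset 'N('O_p^'(G)) := subset_trans sPG (gFnorm _ _).
have solO : solvable 'O_p^'(G) := solvableS (pcore_sub _ _) solG.
have coOP : coprime #|'O_p^'(G)| #|P|.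
  by rewrite coprime_sym; apply: pnat_coprime pP (pcore_pgroup _ _).
apply: solvable_commute_often => //; apply: commute_oftenS oftHP.
(* Every Hall [p']-subgroup of ['L_n(G)] contains its [p']-core, and that core contains the
   commutator. *)
apply: subset_trans (pcore_sub_Hall hallH).
rewrite -(pcore_setI_normal _ (lcn_normal n G)) subsetI commg_subl nOP.
exact: coprime_comm_sub_lcn (pcore_sub _ _) sPG nOP coOP solO.
Qed.

Definition Fitting_order_bound k :=
  ((action_bound k).+1 ^ (action_bound k).+1)%N.

(** In a soluble group whose Fitting subgroup has order at most [m], the centraliser of that
    subgroup has index at most [m ^ m] and order at most [m]. *)
Definition pcore_index_bound k :=
  (Fitting_order_bound k ^ Fitting_order_bound k * Fitting_order_bound k)%N.

Lemma index_pcore_p'core1 gT k n (G : {group gT}) p :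
    solvable G -> sylow_hall_commute k n G -> prime p -> 'O_p^'(G) = 1 ->
  #|G : 'O_p(G)| <= pcore_index_bound k.
Proof.
move=> solG oftG p_pr Op'1; set V := 'O_p(G).
have defV : 'F(G) = V := Fitting_eq_pcore Op'1.
have part_leq q : q \in \pi(G) -> q != p -> #|G|`_q <= action_bound k.
  move=> pi_q neq_qp.
  have [Q sylQ leQ] := sylow_index_cent_pcore solG oftG pi_q.
  have [sQG qQ _] := and3P sylQ.
  have q'V : q^'.-group V.
    by apply: pi_p'group (pcore_pgroup _ _) _; rewrite !inE.
  (* ['O_q^'(G)] contains [V = 'F(G)], so this centraliser lies in [V]; it is a [q]-group inside a
     [q']-group. *)
  suff C1 : 'C_Q('O_q^'(G)) = 1.
    by rewrite -(card_Hall sylQ) -indexg1 -C1.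
  apply/trivgP; rewrite -(coprime_TIg (pnat_coprime qQ q'V)).
  rewrite subsetI subsetIl /=.
  rewrite -/V -defV (subset_trans _ (cent_sub_Fitting solG)) // setISS //.
  by rewrite centS // defV pcore_max ?pcore_normal.
set K := (G / V)%G; have solK : solvable K by apply: quotient_sol.
have F_leq : #|'F(K)| <= Fitting_order_bound k.
  have dvdFG : #|'F(K)| %| #|G|.
    exact: dvdn_trans (cardSg (Fitting_sub K)) (dvdn_quotient G V).
  apply: leq_parts => // q pi_q.
  have pi_qG : q \in \pi(G) := pi_of_dvd dvdFG (cardG_gt0 G) pi_q.
  have dvd_q := partn_dvd q (cardG_gt0 G) dvdFG.
  apply: leq_trans (dvdn_leq (part_gt0 _ _) dvd_q) _; apply: part_leq pi_qG _.
  (* The prime [p] does not occur: [G / 'O_p(G)] has trivial [p]-core. *)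
  apply: contraTneq pi_q => ->.
  have := card_Hall (nilpotent_pcore_Hall p (Fitting_nil K)).
  rewrite /= p_core_Fitting trivg_pcore_quotient cards1 => /esym/eqP.
  by rewrite partG_eq1 p'groupEpi.
rewrite -card_quotient ?gFnorm // -/K.
rewrite -(Lagrange (subsetIl K 'C('F(K)))) mulnC leq_mul //.
  by rewrite index_cent_norm_leq ?gFnorm.
exact: leq_trans (subset_leq_card (cent_sub_Fitting solK)) F_leq.
Qed.

(** The normal subgroup [C] meets [N] in a central subgroup, and [C / (N :&: C)] embeds in the
    [p]-group ['O_p(G / N)]; so [C] is nilpotent. *)
Lemma cent_pcore_sub_Fitting gT (G : {group gT}) (p : nat) :
  'C_(coset 'O_p^'(G) @*^-1 'O_p(G / 'O_p^'(G)))('O_p^'(G)) \subset 'F(G).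
Proof.
set N := 'O_p^'(G)%G; set R := (coset N @*^-1 'O_p(G / N))%G.
set C := ('C_R(N))%G.
have nsNG : N <| G := pcore_normal _ _.
have nsRG : R <| G.
  by rewrite -(quotientGK nsNG) cosetpre_normal pcore_normal.
have nsCG : C <| G.
  rewrite /normal (subset_trans (subsetIl _ _) (normal_sub nsRG)).
  by rewrite normsI ?norms_cent ?normal_norm.
have nNC : C \subset 'N(N) := subset_trans (normal_sub nsCG) (normal_norm nsNG).
apply: Fitting_max nsCG _; apply: (@central_quotient_nil _ _ (N :&: C)).
  by rewrite subsetI subsetIr (subset_trans (subsetIl N C)) // centsC subsetIr.
apply: (@pgroup_nil _ p); rewrite /pgroup (card_isog (second_isog nNC)).
apply: pgroupS (pcore_pgroup p (G / N)).
by rewrite sub_quotient_pre ?subsetIl.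
Qed.

Definition sylow_Fitting_bound k := (action_bound k * pcore_index_bound k)%N.

Lemma sylow_index_Fitting gT k n (G : {group gT}) p :
    solvable G -> sylow_hall_commute k n G -> p \in \pi(G) ->
  exists2 P : {group gT},
    p.-Sylow(G) P & #|P : 'F(G)| <= sylow_Fitting_bound k.
Proof.
move=> solG oftG pi_p.
have [P sylP leP] := sylow_index_cent_pcore solG oftG pi_p.
exists P => //; set N := 'O_p^'(G)%G; set R := (coset N @*^-1 'O_p(G / N))%G.
have p_pr : prime p by move: pi_p; rewrite mem_primes => /andP[].
have leR : #|P : R| <= pcore_index_bound k.
  apply: leq_trans (leq_indexSg _ (pHall_sub sylP)) _.
  rewrite -(quotientGK (pcore_normal p^' G)) index_cosetpre.
  apply: index_pcore_p'core1 p_pr (trivg_pcore_quotient _ _).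
    exact: quotient_sol.
  exact: sylow_hall_commute_quotient (pcore_normal _ _) oftG.
apply: leq_trans (leq_mul leP leR); apply: leq_trans (leq_indexI _ _ _).
apply: leq_indexgS; apply: subset_trans (cent_pcore_sub_Fitting G p).
by rewrite subsetI subsetIr (subset_trans (subsetIl _ _)) // subsetIr.
Qed.

Lemma index_Fitting_bound gT k n (G : {group gT}) :
    solvable G -> sylow_hall_commute k n G ->
  #|G : 'F(G)| <= ((sylow_Fitting_bound k).+1 ^ (sylow_Fitting_bound k).+1)%N.
Proof.
move=> solG oftG; apply: leq_parts => // p pi_p.
have pi_pG : p \in \pi(G) := pi_of_dvd (dvdn_indexg _ _) (cardG_gt0 G) pi_p.
have [P sylP leP] := sylow_index_Fitting solG oftG pi_pG.
have nFP : P \subset 'N('F(G)) := subset_trans (pHall_sub sylP) (gFnorm _ _).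
rewrite -card_quotient ?gFnorm // -(card_Hall (quotient_pHall nFP sylP)).
by rewrite card_quotient.
Qed.

(** * From probabilities to counting, and the final bound *)

Import Order.TTheory GRing.Theory Num.Theory.

(** The series is decreasing, so a term of least order lies in all the others. *)
Lemma gamma_infty_lcn (gT : finGroupType) (G : {group gT}) :
  exists n, gamma_infty G = 'L_n(G).
Proof.
(* [ex_minnP] takes a boolean predicate, hence the search over subsets of a finite type. *)
have ex_n : exists m,
    [exists A : {set gT}, (#|A| == m) && `[< exists n, A = 'L_n(G) >]].
  exists #|G|; apply/existsP; exists (G : {set gT}).
  by rewrite eqxx; apply/asboolP; exists 0.
have [m /existsP[_ /andP[/eqP <- /asboolP[n ->]]] min_n] := ex_minnP ex_n.
exists n; apply/eqP; rewrite eqEsubset; apply/andP; split.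
  by apply/subsetP=> x /gamma_inftyP.
apply/subsetP=> x Lx; apply/gamma_inftyP=> i.
have [le_in | le_ni] := leqP i n;
  first exact: subsetP (lcn_sub_leq G le_in) x Lx.
have /eqP -> // : 'L_i(G) == 'L_n(G).
rewrite eqEcard (lcn_sub_leq G (ltnW le_ni)); apply: min_n.
by apply/existsP; exists 'L_i(G); rewrite eqxx; apply/asboolP; exists i.
Qed.

Lemma commuting_prob_often (R : realType) (eps : R) (gT : finGroupType) k
    (H P : {group gT}) :
    (1 <= k%:R * eps)%R -> (eps <= commuting_prob R H P)%R ->
  commute_often k H P.
Proof.
move=> le1k le_eps; rewrite /commute_often.
have pos (A : {group gT}) : (0 < #|A|%:R :> R)%R by rewrite ltr0n cardG_gt0.
have <- : #|[set u in setX H P | u.1 * u.2 == u.2 * u.1]| =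
    (\sum_(b in P) #|'C_H[b]|)%N.
  rewrite sum_cent1_sym; under eq_bigr do rewrite -sum1_card.
  rewrite pair_big_dep -sum1_card; apply: eq_bigl => -[a b].
  by rewrite inE in_setX in_setI -andbA cent1E eq_sym.
rewrite -(ler_nat R) !natrM; have posHP := mulr_gt0 (pos H) (pos P).
rewrite -[leLHS]mul1r -ler_pdivlMr // -mulrA.
by apply: le_trans le1k _; rewrite ler_wpM2l ?ler0n.
Qed.

Theorem theorem1p2 (R : realType) (eps : R) (eps_gt0 : (0 < eps)%R) :
  exists N : nat,
    forall (gT : finGroupType) (G : {group gT}),
      solvable G ->
      (forall p : nat, p \in \pi(G) ->
         exists P H : {group gT},
           [/\ p.-Sylow(G) P,
               p^'.-Hall(gamma_infty G) H
             & (eps <= commuting_prob R H P)%R]) ->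
      (#|G : 'F(G)| <= N)%N.
Proof.
have [k lek] : exists k : nat, (1 <= k%:R * eps)%R.
  exists (Num.truncn eps^-1).+1.
  by rewrite -ler_pdivrMr // mul1r ltW // truncnS_gt.
exists ((sylow_Fitting_bound k).+1 ^ (sylow_Fitting_bound k).+1)%N.
(* This [n] depends on [G], but the bound does not involve it. *)
move=> gT G solG hypG; have [n def_n] := gamma_infty_lcn G.
apply: (index_Fitting_bound (n := n)) => // p pi_p.
have [P [H [sylP hallH le_eps]]] := hypG p pi_p; exists P, H.
by rewrite -def_n; split=> //; apply: commuting_prob_often lek le_eps.
Qed.
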